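(* Let $X$ and $Y$ be two compact doubling metric spaces. Suppose $(X,\mu,\mathcal F)$ is a box-counting space and $f:X\to Y$ is a bi-Lipschitz map (in particular a bijection). Then $(Y,f^*\mu,f(\mathcal F))$ is a box-counting space, where $f^*\mu(A):=\mu(f^{-1}(A))$ and $f(\mathcal F)=\{f(\mathcal F_k)\}_{k\ge1}$ with $f(\mathcal F_k)=\{f(A): A\in\mathcal F_k\}$.
   Context: Let $(X,d_X)$ be a compact metric space; $B(x,r)$ denotes the (open) ball in $X$ with center $x$ and radius $r$. For $A\subset X$ and $\delta>0$, a family of balls of $X$ of radius $\delta$ is a $\delta$-ball-packing of $A$ if the balls are pairwise disjoint and their centers lie in $A$. $\mathcal N_\delta(A)$ is the maximal cardinality of a $\delta$-ball-packing of $A$. The box dimension is $\dim_B X=\lim_{\delta\to0}\frac{\log \mathcal N_\delta(X)}{-\log\delta}$, when this limit exists. Compact Vitalli-type covering: a sequence $\mathcal F=\{\mathcal F_k\}_{k\ge1}$ where each $\mathcal F_k$ is a covering of $X$ by subsets of $X$, such that (i) every element of $\mathcal F_k$ is compact; (ii) there is an integer $\lambda$ such that for all $k\ge1$ every point $x\in X$ is covered by at most $\lambda$ elements of $\mathcal F_k$; (iii) $\max\{\operatorname{diam}A: A\in\mathcal F_k\}\to0$ as $k\to\infty$. Box-counting space: suppose $\beta=\dim_B X$ exists, let $\mu$ be a finite Borel measure on $X$ and $\mathcal F$ a compact Vitalli-type covering of $X$. $(X,\mu,\mathcal F)$ is a box-counting space if there is a constant $M>0$ such that for every $R\in\bigcup_{k\ge1}\mathcal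 F_k$ there is $\delta_0(R)>0$ with $$M^{-1}\mu(R)\le \mathcal N_\delta(R)\,\delta^{\beta}\le M\mu(R)\qquad\text{for all }0<\delta\le\delta_0(R).$$ A metric space $X$ is doubling if there is a constant $C>0$ such that for all $x\in X$, $r>0$, the ball $B(x,2r)$ can be covered by $C$ balls of radius $r$. A bijection $f:(X,d_X)\to(Y,d_Y)$ is bi-Lipschitz if there is $C>0$ with $C^{-1}d_X(x,y)\le d_Y(f(x),f(y))\le Cd_X(x,y)$ for all $x,y\in X$. *)

(* Defs.v *)
From HB Require Import structures.
From mathcomp Require Import all_boot all_order all_algebra finmap.
From mathcomp Require Import all_classical all_reals all_analysis.

Set Implicit Arguments.
Unset Strict Implicit.
Unset Printing Implicit Defensive.

Import Order.TTheory GRing.Theory Num.Theory.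
Import numFieldNormedType.Exports.

Local Open Scope classical_set_scope.
Local Open Scope ring_scope.

(* Nonempty metric spaces: measurable types carry a distinguished point. *)
#[short(type="pmetricType")]
HB.structure Definition PointedMetric (K : numDomainType) :=
  { M of Metric K M & isPointed M }.

Definition borel (T : ptopologicalType) := g_sigma_algebraType (@open T).

Section box_counting.
Context {R : realType}.
Implicit Types X Y : pmetricType R.

Definition is_finite_borel_measure X (mu : set (borel X) -> \bar R) : Prop :=
  exists nu : {finite_measure set (borel X) -> \bar R}, mu = nu.

(* A packing is given by its finite set of centers; [trivIset] forces distinct
   centers to have disjoint (hence distinct) balls. *)
Definition ball_packing X (delta : R) (A : set X) (P : {fset X}) : Prop :=
  [set` P] `<=` A /\ trivIset [set` P] (fun x => ball x delta).

(* Equals +oo when there are arbitrarily large packings, which cannot happen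
   in a compact space. *)
Definition packing_number X (delta : R) (A : set X) : \bar R :=
  ereal_sup [set (#|` P|%:R)%:E | P in ball_packing delta A].

Definition is_box_dim X (beta : R) : Prop :=
  (lne (packing_number delta [set: X]) * ((- ln delta)^-1)%:E)%E
    @[delta --> 0^'+] --> beta%:E.

(* The point 0 is added so that the empty set has diameter 0. *)
Definition diam X (A : set X) : \bar R :=
  ereal_sup (0%E |` [set (mdist p.1 p.2)%:E | p in A `*` A]).

(* [F k] is the (k+1)-st covering of the sequence. *)
Definition compact_vitali_covering X (F : nat -> set (set X)) : Prop :=
  [/\ forall k, \bigcup_(A in F k) A = [set: X],
      forall k A, F k A -> compact A,
      exists lambda : nat, forall k x,
        ([set A | F k A /\ A x] #<= `I_lambda)%card
    & ereal_sup [set diam A | A in F k] @[k --> \oo] --> 0%E].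

Definition box_counting_space X (mu : set (borel X) -> \bar R)
    (F : nat -> set (set X)) : Prop :=
  [/\ is_finite_borel_measure mu, compact_vitali_covering F &
    exists2 beta : R, is_box_dim X beta &
    exists2 M : R, 0 < M &
    forall A, (\bigcup_k F k) A ->
    exists2 delta0 : R, 0 < delta0 &
    forall delta : R, 0 < delta <= delta0 ->
    ((M^-1)%:E * mu A <= packing_number delta A * (delta `^ beta)%:E
                      <= M%:E * mu A)%E].

Definition doubling X : Prop :=
  exists2 C : nat, (0 < C)%N &
  forall (x : X) (r : R), 0 < r ->
  exists c : 'I_C -> X, ball x (2 * r) `<=` \bigcup_i ball (c i) r.

Definition bi_lipschitz X Y (f : X -> Y) : Prop :=
  bijective f /\
  exists2 C : R, 0 < C &
  forall x y : X, C^-1 * mdist x y <= mdist (f x) (f y) <= C * mdist x y.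

End box_counting.

(* Main.v *)
(* Distinct centers x, y of a delta-packing satisfy d(x,y) >= delta; conversely
   disjoint balls are guaranteed by d(x,y) >= 2 delta. Hence a map expanding
   distances by at least c sends the centers of a delta-packing of A to those
   of a (c delta/2)-packing of f(A). Applied to f and to its inverse this gives,
   with k = 1/(2C),
     N_delta(A) <= N_(k delta)(f A)  and  N_delta(f A) <= N_(k delta)(A).
   Replacing delta by k delta changes delta^beta by the constant k^beta and
   log delta by a bounded amount, so the box dimension is preserved, and so are
   the box-counting inequalities with M replaced by M k^-beta. *)
Require Import Defs.
From HB Require Import structures.
From mathcomp Require Import all_boot all_order all_algebra finmap.
From mathcomp Require Import all_classical all_reals all_analysis.
From mathcomp Require Import lra.
Import Order.TTheory GRing.Theory Num.Theory.
Import numFieldNormedType.Exports.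
Local Open Scope classical_set_scope.
Local Open Scope ring_scope.

(** * Packing numbers under expanding maps *)

(** Were the centers closer than [delta], [y] itself would lie in both balls. In a general metric
    space disjointness does not give [2 * delta], as there may be no midpoints. *)
Lemma ball_packing_separated (R : realType) (X : pmetricType R) (delta : R)
    (A : set X) (P : {fset X}) (x y : X) :
  0 < delta -> ball_packing delta A P -> x \in P -> y \in P -> x != y ->
  delta <= mdist x y.
Proof.
move=> d0 [_ /trivIsetP tP] xP yP xy; rewrite leNgt; apply/negP => xyd.
have := tP _ _ xP yP xy; apply/eqP/set0P; exists y; split.
  by rewrite ballEmdist.
exact: ballxx.
Qed.

Lemma packing_number_ge0 (R : realType) (X : pmetricType R) (delta : R)
    (A : set X) : (0 <= packing_number delta A)%E.
Proof.
apply: ereal_sup_ubound; exists fset0; last by rewrite cardfs0.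
by split => [x|x y]; rewrite /= in_fset0.
Qed.

Lemma packing_number_expanding (R : realType) (X Y : pmetricType R)
    (f : X -> Y) (c delta : R) (A : set X) :
  0 < c -> 0 < delta -> (forall x y, c * mdist x y <= mdist (f x) (f y)) ->
  (packing_number delta A <= packing_number (c / 2 * delta) (f @` A))%E.
Proof.
move=> c0 d0 cf; apply: ge_ereal_sup => _ [P PA <-].
have f_inj : injective f.
  move=> x y fxy; apply/eqP/negPn/negP => xy.
  have := cf x y; rewrite fxy mdistxx leNgt mulr_gt0//.
  by rewrite mdist_gt0.
apply: ereal_sup_ubound; exists (f @` P)%fset; last by rewrite card_imfset.
split.
  move=> _ /imfsetP[x /= xP ->]; by exists x => //; apply: PA.1.
apply/trivIsetP => _ _ /imfsetP[x /= xP ->] /imfsetP[y /= yP ->] fxy.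
have xy : x != y by apply: contra_neq fxy => ->.
have dxy := ball_packing_separated _ _ _ _ _ _ _ d0 PA xP yP xy.
(* A common point [z] of the two balls would put [f x] and [f y] at distance less than
   [c * delta]. *)
rewrite -subset0 => z []; rewrite !ballEmdist /= => xz yz.
have := metric_triangle (f x) z (f y); rewrite (metric_sym z).
have := cf x y; have : c * delta <= c * mdist x y by rewrite ler_pM2l.
lra.
Qed.

(** * Rescaling the radius, and invariance of the box dimension *)

Lemma at_right0_scale (R : realType) (k : R) :
  0 < k -> k * delta @[delta --> 0^'+] --> 0^'+.
Proof.
move=> k0 A [e /= e0 eA]; exists (e / k) => /=; first exact: divr_gt0.
move=> x /=; rewrite sub0r normrN => xe x0; apply: eA => /=.
  by rewrite sub0r normrN normrM (gtr0_norm k0) mulrC -ltr_pdivlMr.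
exact: mulr_gt0.
Qed.

(** The ratio equals [1 + ln k / ln delta], and [ln delta] tends to minus infinity. *)
Lemma ln_scale_ratio (R : realType) (k : R) :
  0 < k -> ln (k * delta) / ln delta @[delta --> 0^'+] --> (1 : R).
Proof.
move=> k0.
have ln_lt0' : \forall d \near (0 : R)^'+, ln d < 0.
  near=> d; apply: ln_lt0; apply/andP; split.
    by near: d; exact: nbhs_right_gt.
  by near: d; exact: nbhs_right_lt.
have lnV0 : (ln d)^-1 @[d --> 0^'+] --> (0 : R).
  exact: (iffRL (ltr0_cvgV0 ln_lt0') (@lnNy R)).
have : 1 + ln k * (ln d)^-1 @[d --> 0^'+] --> 1 + ln k * 0.
  by apply: cvgD; [exact: cvg_cst|apply: cvgM => //; exact: cvg_cst].
rewrite mulr0 addr0; apply: cvg_trans; apply: near_eq_cvg.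
near=> d; have d0 : 0 < d by near: d; exact: nbhs_right_gt.
have lnd : ln d != 0 by apply: ltr0_neq0; near: d.
by rewrite lnM ?posrE// mulrDl divff// addrC.
Unshelve. all: by end_near. Qed.

(** Composing the limit with the scaling also puts [k * delta] in the denominator; multiplying by
    [ln (k * delta) / ln delta], which tends to 1, restores [ln delta]. *)
Lemma cvg_box_quotient_scale (R : realType) (N : R -> \bar R) (k beta : R) :
  0 < k ->
  (lne (N delta) * ((- ln delta)^-1)%:E)%E @[delta --> 0^'+] --> beta%:E ->
  (lne (N (k * delta)%R) * ((- ln delta)^-1)%:E)%E @[delta --> 0^'+] --> beta%:E.
Proof.
move=> k0 Nb.
have Nk := cvg_comp _ _ (at_right0_scale _ _ k0) Nb.
have ratio : (ln (k * d) / ln d)%:E @[d --> 0^'+] --> (1 : R)%:E.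
  by apply: cvg_EFin; [exact: nearW|exact: ln_scale_ratio].
have fin1 : (beta%:E *? 1)%E by exact: mule_def_fin.
have := cvgeM fin1 Nk ratio; rewrite mule1 => /(_ _) Nr.
apply: cvg_trans Nr; apply: near_eq_cvg; near=> d.
have d0 : 0 < d by near: d; exact: nbhs_right_gt.
have kd0 : 0 < k * d by exact: mulr_gt0.
(* Cancelling [ln (k * d)] requires [k * d] to differ from 1; it is eventually smaller. *)
have lnkd : ln (k * d) != 0.
  apply: ltr0_neq0; apply: ln_lt0; rewrite kd0/= mulrC -ltr_pdivlMr// mul1r.
  by near: d; apply: nbhs_right_lt; rewrite invr_gt0.
rewrite /= -muleA -EFinM !invrN mulNr; congr (_ * (- _)%:E)%E.
by rewrite mulrA mulVf// mul1r.
Unshelve. all: by end_near. Qed.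

Lemma le_lne_packing_number (R : realType) (X Y : pmetricType R)
    (A : set X) (B : set Y) (d e : R) :
  (packing_number d A <= packing_number e B)%E ->
  (lne (packing_number d A) <= lne (packing_number e B))%E.
Proof.
by move=> AB; rewrite lee_lne// in_itv/= leey packing_number_ge0.
Qed.

(** The quotient of [Y] at [d] is squeezed between those of [X] with packing radii [k^-1 * d]
    (through [f]) and [k * d] (through [g]). *)
Lemma is_box_dim_bi_expanding (R : realType) (X Y : pmetricType R)
    (f : X -> Y) (g : Y -> X) (c beta : R) :
  0 < c -> cancel g f -> cancel f g ->
  (forall x y, c * mdist x y <= mdist (f x) (f y)) ->
  (forall x y, c * mdist x y <= mdist (g x) (g y)) ->
  is_box_dim X beta -> is_box_dim Y beta.
Proof.
move=> c0 gK fK cf cg Xbeta; set k := c / 2.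
have k0 : 0 < k by rewrite divr_gt0.
have kV0 : 0 < k^-1 by rewrite invr_gt0.
apply: squeeze_cvge (cvg_box_quotient_scale _ _ _ _ kV0 Xbeta)
  (cvg_box_quotient_scale _ _ _ _ k0 Xbeta).
near=> d; have d0 : 0 < d by near: d; exact: nbhs_right_gt.
have fT : f @` setT = setT.
  by apply/seteqP; split=> // y _; exists (g y).
have gT : g @` setT = setT.
  by apply/seteqP; split=> // y _; exists (f y).
(* For [d] at most 1 the factor is nonnegative, so it preserves inequalities. *)
have lnd : (0 <= ((- ln d)^-1)%:E)%E.
  rewrite lee_fin invr_ge0 oppr_ge0; apply: ln_le0.
  by near: d; exact: nbhs_right_le.
apply/andP; split; apply: lee_wpmul2r => //; apply: le_lne_packing_number.
- have := packing_number_expanding _ _ _ f c (k^-1 * d) setT c0.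
  by rewrite fT mulrA divff ?gt_eqF// mul1r; apply => //; exact: mulr_gt0.
- by have := packing_number_expanding _ _ _ g c d setT c0; rewrite gT; apply.
Unshelve. all: by end_near. Qed.

(** * Push-forward of finite Borel measures *)

Lemma lipschitz_continuous (R : realType) (X Y : pmetricType R) (f : X -> Y)
    (C : R) :
  0 < C -> (forall x y, mdist (f x) (f y) <= C * mdist x y) -> continuous f.
Proof.
move=> C0 fC x; apply/cvg_ballP => e e0.
have : \forall y \near x, ball x (e / C) y by apply: nbhsx_ballx; exact: divr_gt0.
apply: filterS => y; rewrite !ballEmdist /= => xy; apply: le_lt_trans (fC x y) _.
by rewrite mulrC -ltr_pdivlMr.
Qed.

Lemma continuous_borel_measurable (X Y : ptopologicalType)
    (f : X -> Y) :
  continuous f -> measurable_fun [set: borel X] (f : borel X -> borel Y).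
Proof.
move=> /continuousP cf; apply: (measurability (rT := borel Y) (@open Y)) => //.
move=> _ [B oB <-]; rewrite setTI; apply: sub_sigma_algebra; exact: cf.
Qed.

Lemma finite_measure_pushforward (d d' : measure_display)
    (T1 : measurableType d) (T2 : measurableType d') (R : realType)
    (mu : {finite_measure set T1 -> \bar R}) (f : T1 -> T2) :
  measurable_fun setT f ->
  exists nu : {finite_measure set T2 -> \bar R}, pushforward mu f = nu.
Proof.
move=> mf.
have fin : fin_num_fun (pushforward mu f).
  move=> A mA; apply: fin_num_measure.
  by rewrite -[X in measurable X]setTI; exact: (mf measurableT A mA).
unshelve epose (m := (pushforward mu f : {measure set T2 -> \bar R})).
  exact: mf.
pose finm := Measure_isFinite.Build _ _ _ m fin.
(* [HB.pack] abstracts the proof of measurability on which the canonical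
   measure structure of [pushforward] depends. *)
pose nu : {finite_measure set T2 -> \bar R} := HB.pack (pushforward mu f) finm.
by exists (nu mf).
Qed.

Lemma is_finite_borel_measure_pushforward (R : realType) (X Y : pmetricType R)
    (mu : set (borel X) -> \bar R) (f : X -> Y) :
  continuous f -> is_finite_borel_measure mu ->
  is_finite_borel_measure (pushforward mu (f : borel X -> borel Y)).
Proof.
move=> cf [nu ->]; apply: finite_measure_pushforward.
exact: continuous_borel_measurable.
Qed.

(** * Images of compact Vitali-type coverings *)

Lemma diam_ge0 (R : realType) (X : pmetricType R) (A : set X) :
  (0 <= diam A)%E.
Proof. by apply: ereal_sup_ubound; left. Qed.

Lemma diam_image_lipschitz (R : realType) (X Y : pmetricType R)
    (f : X -> Y) (C : R) (A : set X) :
  0 < C -> (forall x y, mdist (f x) (f y) <= C * mdist x y) ->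
  (diam (f @` A) <= C%:E * diam A)%E.
Proof.
move=> C0 fC; apply: ge_ereal_sup => _ [->|[[_ _] /= [[x Ax <-] [y Ay <-]] <-]].
  by rewrite mule_ge0 ?diam_ge0// lee_fin ltW.
apply: (@le_trans _ _ (C%:E * (mdist x y)%:E)%E); first by rewrite lee_fin.
apply: lee_wpmul2l; first by rewrite lee_fin ltW.
by apply: ereal_sup_ubound; right; exists (x, y).
Qed.

Lemma compact_vitali_covering_image (R : realType) (X Y : pmetricType R)
    (f : X -> Y) (C : R) (F : nat -> set (set X)) :
  bijective f -> 0 < C -> (forall x y, mdist (f x) (f y) <= C * mdist x y) ->
  compact_vitali_covering F ->
  compact_vitali_covering (fun k => [set f @` A | A in F k]).
Proof.
move=> [g fK gK] C0 fC [Fcov Fcpt [lambda Fmult] Fdiam].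
have Fcov' k x : exists2 A, F k A & A x.
  have : (\bigcup_(A in F k) A) x by rewrite Fcov.
  by case=> A; exists A.
split.
- move=> k; apply/seteqP; split=> // y _.
  have [A FA Ay] := Fcov' k (g y).
  by exists (f @` A); [exists A|exists (g y)].
- move=> k _ [A FA <-]; apply: continuous_compact; last exact: Fcpt FA.
  by apply: continuous_subspaceT; exact: lipschitz_continuous C0 fC.
(* The members through [y] are images of members through [g y], so the same [lambda] works. *)
- exists lambda => k y; apply: card_le_trans (Fmult k (g y)).
  apply: (card_le_trans (B := image [set A | F k A /\ A (g y)] (image^~ f))).
    apply: subset_card_le => _ [[A FA <-] [x Ax fx]].
    by exists A => //; split => //; rewrite -fx fK.
  exact: card_image_le.
- have CF : (C%:E * ereal_sup [set diam A | A in F k])%E @[k --> \oo]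
      --> (C%:E * 0)%E by apply: cvgeZl.
  rewrite mule0 in CF.
  apply: squeeze_cvge (@cvg_cst _ _ _ _ _) CF.
  apply: nearW => k; apply/andP; split.
    (* The supremum of an empty family would be [-oo]; covering the distinguished point shows that
       [F k] is nonempty. *)
    have [A FA _] := Fcov' k point.
    apply: le_trans (diam_ge0 _ _ (f @` A)) _.
    by apply: ereal_sup_ubound; exists (f @` A) => //; exists A.
  apply: ge_ereal_sup => _ [_ [A FA <-] <-].
  apply: le_trans (diam_image_lipschitz _ _ _ _ _ _ C0 fC) _.
  apply: lee_wpmul2l; first by rewrite lee_fin ltW.
  by apply: ereal_sup_ubound; exists A.
Qed.

(** * Transfer of the box-counting inequalities *)

Lemma box_counting_bounds_image (R : realType) (X Y : pmetricType R)
    (f : X -> Y) (g : Y -> X) (c beta M delta0 : R) (A : set X) (m : \bar R) :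
  0 < c -> cancel f g ->
  (forall x y, c * mdist x y <= mdist (f x) (f y)) ->
  (forall x y, c * mdist x y <= mdist (g x) (g y)) ->
  0 < delta0 ->
  (forall delta : R, 0 < delta <= delta0 ->
    (M^-1%:E * m <= packing_number delta A * (delta `^ beta)%:E <= M%:E * m)%E) ->
  exists2 delta1 : R, 0 < delta1 &
  forall delta : R, 0 < delta <= delta1 ->
    ((M * (c / 2) `^ (- beta))^-1%:E * m
       <= packing_number delta (f @` A) * (delta `^ beta)%:E
       <= (M * (c / 2) `^ (- beta))%:E * m)%E.
Proof.
move=> c0 fK cf cg d00 Abnd; set k := c / 2.
have k0 : 0 < k by rewrite divr_gt0.
have kb0 : 0 < k `^ beta by exact: powR_gt0.
(* The bounds for [A] are used at radius [k^-1 * d] for the lower estimate and [k * d] for the upper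
   one; both must be at most [delta0]. *)
exists (Num.min (delta0 / k) (delta0 * k)).
  by rewrite lt_min divr_gt0//= mulr_gt0.
move=> d /andP[d0]; rewrite le_min => /andP[dk dkV].
rewrite powRN; apply/andP; split.
- have e0 : 0 < k^-1 * d by rewrite mulr_gt0// invr_gt0.
  have := packing_number_expanding _ _ _ f c (k^-1 * d) A c0 e0 cf.
  rewrite mulrA divff ?gt_eqF// mul1r => NfA.
  have /andP[+ _] : (M^-1%:E * m <= packing_number (k^-1 * d) A *
      ((k^-1 * d) `^ beta)%:E <= M%:E * m)%E.
    by apply: Abnd; rewrite e0/= mulrC ler_pdivrMr.
  (* Multiplying by the [beta]-th power of [k] turns that of [k^-1 * d] into that of [d]. *)
  move=> /(lee_wpmul2l (x := (k `^ beta)%:E)).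
  rewrite lee_fin => /(_ (ltW kb0)) H.
  rewrite invfM invrK mulrC EFinM -muleA; apply: le_trans H _.
  rewrite muleCA -EFinM -powRM; [|exact: ltW|exact: ltW].
  rewrite mulrA divff ?gt_eqF// mul1r.
  by apply: lee_wpmul2r => //; rewrite lee_fin powR_ge0.
- have := packing_number_expanding _ _ _ g c d (f @` A) c0 d0 cg.
  rewrite image_comp (_ : g \o f = id) ?image_id; last first.
    by apply/funext => x; exact: fK.
  move=> NA.
  have /andP[_ +] : (M^-1%:E * m <= packing_number (k * d) A *
      ((k * d) `^ beta)%:E <= M%:E * m)%E.
    by apply: Abnd; rewrite mulr_gt0//= mulrC -ler_pdivlMr.
  rewrite [M / _]mulrC EFinM -muleA lee_pdivlMl// => H.
  apply: le_trans H; rewrite powRM; [|exact: ltW|exact: ltW].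
  rewrite EFinM muleCA -!EFinM.
  by apply: lee_wpmul2r => //; rewrite lee_fin mulr_ge0 ?powR_ge0.
Qed.

Theorem theorem1p3 (R : realType) (X Y : pmetricType R)
    (mu : set (borel X) -> \bar R) (F : nat -> set (set X)) (f : X -> Y) :
  compact [set: X] -> compact [set: Y] -> doubling X -> doubling Y ->
  box_counting_space mu F -> bi_lipschitz f ->
  box_counting_space (pushforward mu (f : borel X -> borel Y))
    (fun k => [set f @` A | A in F k]).
Proof.
move=> _ _ _ _ [mu_fin Fcov [beta Xbeta [M M0 Fbnd]]] [f_bij [C C0 fC]].
have fC_le x y : mdist (f x) (f y) <= C * mdist x y by case/andP: (fC x y).
have cf x y : C^-1 * mdist x y <= mdist (f x) (f y) by case/andP: (fC x y).
have [g fK gK] := f_bij.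
(* This is the upper Lipschitz bound of [f] at the points [g x] and [g y]. *)
have cg x y : C^-1 * mdist x y <= mdist (g x) (g y).
  by rewrite mulrC ler_pdivrMr// mulrC -{1}(gK x) -{1}(gK y).
have c0 : 0 < C^-1 by rewrite invr_gt0.
split.
- apply: is_finite_borel_measure_pushforward mu_fin.
  exact: lipschitz_continuous C0 fC_le.
- exact: compact_vitali_covering_image f_bij C0 fC_le Fcov.
exists beta; first exact: is_box_dim_bi_expanding c0 gK fK cf cg Xbeta.
exists (M * (C^-1 / 2) `^ (- beta)); first by rewrite mulr_gt0 ?powR_gt0 ?divr_gt0.
move=> _ [k _ [A FA <-]].
have [|delta0 d00 Abnd] := Fbnd A; first by exists k.
have -> : pushforward mu (f : borel X -> borel Y) (f @` A) = mu A.
  congr mu; apply/seteqP; split=> [x [y Ay /(can_inj fK) <-]//|x Ax].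
  by exists x.
exact: box_counting_bounds_image c0 fK cf cg d00 Abnd.
Qed.
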